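(* Let $P_n$ and $Q_n$ ($n\ge 0$) be the polynomials defined by $P_0(u)=u$, $P_{n+1}(u)=(1+u^2)P_n'(u)$ and $Q_0(u)=1$, $Q_{n+1}(u)=(1+u^2)Q_n'(u)+uQ_n(u)$, so that $\frac{d^n}{dx^n}\tan x=P_n(\tan x)$ and $\frac{d^n}{dx^n}\sec x=\sec x\,Q_n(\tan x)$. For $n\ge1$ let $$W_n(x)=\sum_{\pi\in S_n}x^{\mathrm{pk}(\pi)},\qquad W^{l}_n(x)=\sum_{\pi\in S_n}x^{\mathrm{lpk}(\pi)}.$$ Then for every $n\ge 1$ and every real $u>1$, $$W_n(u)=(u-1)^{\frac{n+1}{2}}u^{-1}P_n\big((u-1)^{-1/2}\big)\quad\text{and}\quad W^{l}_n(u)=(u-1)^{\frac n2}Q_n\big((u-1)^{-1/2}\big).$$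
   Context: $S_n$ is the symmetric group on $[n]=\{1,\dots,n\}$, permutations written $\pi=\pi(1)\cdots\pi(n)$. An interior peak of $\pi$ is an index $i\in\{2,\dots,n-1\}$ with $\pi(i-1)<\pi(i)>\pi(i+1)$; $\mathrm{pk}(\pi)$ is the number of interior peaks. A left peak of $\pi$ is an index $i\in[n-1]$ with $\pi(i-1)<\pi(i)>\pi(i+1)$, where $\pi(0):=0$; $\mathrm{lpk}(\pi)$ is the number of left peaks. Powers of $u-1>0$ denote positive real powers. *)

(* Defs.v *)
From HB Require Import structures.
From mathcomp Require Import all_boot all_order all_algebra all_fingroup.
From mathcomp Require Import reals exp.
Set Implicit Arguments. Unset Strict Implicit. Unset Printing Implicit Defensive.
Import Order.TTheory GRing.Theory Num.Theory.
Local Open Scope ring_scope.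

Fixpoint Ppoly (R : ringType) (n : nat) : {poly R} :=
  match n with
  | 0 => 'X
  | m.+1 => (1 + 'X ^+ 2) * (Ppoly R m)^`()
  end.

Fixpoint Qpoly (R : ringType) (n : nat) : {poly R} :=
  match n with
  | 0 => 1
  | m.+1 => (1 + 'X ^+ 2) * (Qpoly R m)^`() + 'X * Qpoly R m
  end.

(* pval s i = pi(i) with the paper's 1-based conventions: for s : 'S_n,
   pi(i) = (s (i-1)) + 1 for 1 <= i <= n, and pi(0) := 0 (also 0 out of range). *)
Definition pval (n : nat) (s : 'S_n) (i : nat) : nat :=
  match i with
  | 0 => 0
  | i'.+1 => match insub i' : option 'I_n with
             | Some j => (s j).+1
             | None => 0
             end
  end.

Definition is_peak (n : nat) (s : 'S_n) (i : nat) : bool :=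
  (pval s i.-1 < pval s i)%N && (pval s i.+1 < pval s i)%N.

Definition pk (n : nat) (s : 'S_n) : nat := count (is_peak s) (iota 2 (n - 2)).

Definition lpk (n : nat) (s : 'S_n) : nat := count (is_peak s) (iota 1 (n - 1)).

Definition Wpk (R : ringType) (n : nat) (x : R) : R := \sum_(s : 'S_n) x ^+ pk s.
Definition Wlpk (R : ringType) (n : nat) (x : R) : R := \sum_(s : 'S_n) x ^+ lpk s.

(* Main.v *)
Require Import Defs.
From HB Require Import structures.
From mathcomp Require Import all_boot all_order all_algebra all_fingroup.
From mathcomp Require Import reals exp.
From mathcomp Require Import zify ring.
Import Order.TTheory GRing.Theory Num.Theory.
Set Implicit Arguments. Unset Strict Implicit. Unset Printing Implicit Defensive.

(* Inserting the maximum n+1 into the n+1 slots of a permutation of [n] with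
   k peaks gives the recurrence
     W_(n+1) = (a + (n+1-a) x) W_n + 2 x (1 - x) W_n',
   with a = 2 for interior peaks and a = 1 for left peaks: the 2k slots next
   to a peak keep the peak count, the other slots in range add one.  After the
   substitution x = 1 + t^2 and the reversal t^N p(1/t), this is exactly the
   recurrence defining P_n (resp. Q_n), so that
     t^(n+1) P_n(1/t) = (1 + t^2) W_n(1 + t^2),   t^n Q_n(1/t) = W^l_n(1 + t^2),
   and the theorem is the case t = sqrt(u - 1). *)

Section Peaks.
Local Open Scope nat_scope.

(* Sequences are functions [nat -> nat], like the zero-padded one-line
   notation [pval s] of a permutation. *)
Definition peakb (g : nat -> nat) i := (g i.-1 < g i) && (g i.+1 < g i).

Definition npeaks a n g := count (peakb g) (iota a (n - a)).

Definition insert_at p M (g : nat -> nat) k :=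
  if k < p then g k else if k == p then M else g k.-1.

Lemma eq_npeaks a n g1 g2 : g1 =1 g2 -> npeaks a n g1 = npeaks a n g2.
Proof. by move=> eq_g; apply: eq_count => i; rewrite /peakb !eq_g. Qed.

Lemma peakb_nonadjacent g i : ~~ (peakb g i && peakb g i.+1).
Proof. by rewrite /peakb /=; lia. Qed.

Lemma insert_at_lt p M g k : k < p -> insert_at p M g k = g k.
Proof. by rewrite /insert_at => ->. Qed.

Lemma insert_at_eq p M g : insert_at p M g p = M.
Proof. by rewrite /insert_at ltnn eqxx. Qed.

Lemma insert_at_gt p M g k : p < k -> insert_at p M g k = g k.-1.
Proof. by move=> pk; rewrite /insert_at ltnNge ltnW // gtn_eqF. Qed.

Lemma peakb_insert p M g i : (forall k, g k < M) ->
  peakb (insert_at p.+1 M g) i =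
  [|| (i < p) && peakb g i, i == p.+1 | (p.+2 < i) && peakb g i.-1].
Proof.
move=> gM; rewrite /peakb.
have : i < p \/ i = p \/ i = p.+1 \/ i = p.+2 \/ p.+2 < i by lia.
case=> [ip|[->|[->|[->|pi]]]].
- by rewrite !insert_at_lt ?ip //=; lia.
- rewrite (@insert_at_lt _ _ _ p) // insert_at_eq.
  have := gM p; lia.
- rewrite (@insert_at_lt _ _ _ p) // insert_at_eq (@insert_at_gt _ _ _ p.+2) //=.
  have := gM p; have := gM p.+1; lia.
- rewrite (@insert_at_gt _ _ _ p.+2) // (@insert_at_gt _ _ _ p.+3) //= insert_at_eq.
  have := gM p.+1; lia.
- rewrite !insert_at_gt //= ?prednK; lia.
Qed.

Lemma count_iota_sum (P : pred nat) a n N : n <= N ->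
  count P (iota a (n - a)) = \sum_(i < N) ((a <= i < n) && P i).
Proof.
move=> nN; rewrite -sum1_count -/(index_iota a n) (big_nat_widenl _ 0) //.
rewrite (big_nat_widen _ _ _ _ _ nN) big_mkord big_mkcond /=.
by apply: eq_bigr => i _; case: (P i); case: (a <= i); case: (i < n).
Qed.

Lemma sum_ord_eq_and N c (b : bool) : c < N -> \sum_(i < N) ((i == c :> nat) && b) = b.
Proof.
move=> cN; rewrite (bigD1 (Ordinal cN)) //= eqxx big1 ?addn0 // => i ic.
by rewrite -val_eqE /= in ic; rewrite (negbTE ic).
Qed.

(* Inserting a maximum at index p+1 creates the peak p+1 (when it is counted)
   and destroys the peaks of g at p and p+1, shifting the later ones. *)
Lemma npeaks_insert a m p M g : 0 < a <= 2 -> p <= m -> (forall k, g k < M) ->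
  npeaks a m.+1 (insert_at p.+1 M g)
    + ((a <= p < m) && peakb g p) + ((a <= p.+1 < m) && peakb g p.+1)
  = npeaks a m g + (a <= p.+1 <= m).
Proof.
move=> a12 pm gM.
rewrite /npeaks (count_iota_sum _ _ (leqnSn m.+1)) (count_iota_sum _ _ (leqW (leqnSn m))).
have split_new i : (a <= i < m.+1) && peakb (insert_at p.+1 M g) i =
    (a <= i) && (i < p) && peakb g i + (i == p.+1) && (a <= p.+1 <= m)
    + (p.+2 < i < m.+1) && peakb g i.-1 :> nat.
  by rewrite peakb_insert //; case: (peakb g i); case: (peakb g i.-1); lia.
have split_old i : (a <= i < m) && peakb g i =
    (a <= i) && (i < p) && peakb g i + (i == p) && ((a <= p < m) && peakb g p)
    + (i == p.+1) && ((a <= p.+1 < m) && peakb g p.+1)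
    + (p.+1 < i < m) && peakb g i :> nat.
  have [->|ip] := eqVneq i p; first by case: (peakb g p); lia.
  have [->|ip1] := eqVneq i p.+1; first by case: (peakb g p.+1); lia.
  by case: (peakb g i); lia.
have shift : \sum_(i < m.+2) ((p.+2 < i < m.+1) && peakb g i.-1)
    = \sum_(i < m.+2) ((p.+1 < i < m) && peakb g i).
  rewrite [LHS]big_ord_recl [RHS]big_ord_recr /= (leq_gtF (leqnSn m)) andbF add0n addn0.
  by apply: eq_bigr => i _; rewrite /bump !ltnS.
under eq_bigr => i _ do rewrite split_new.
under [in RHS]eq_bigr => i _ do rewrite split_old.
rewrite !big_split /= shift !sum_ord_eq_and //; last lia.
by move: (\sum_(_ < _) _) (\sum_(_ < _) _) => A C; lia.
Qed.

(* Every counted peak of g lies next to exactly two of the m+1 slots. *)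
Lemma sum_adjacent_peaks a m g : 0 < a ->
  \sum_(p < m.+1) ((a <= p < m) && peakb g p + (a <= p.+1 < m) && peakb g p.+1)
  = 2 * npeaks a m g.
Proof.
move=> a0; rewrite big_split /= -count_iota_sum //.
have := count_iota_sum (peakb g) a (leqW (leqnSn m)).
rewrite big_ord_recl /= -/(npeaks a m g).
under eq_bigr => i _ do rewrite /bump leq0n add1n.
by move: (\sum_(_ < _) _) => S; lia.
Qed.

End Peaks.

Local Open Scope ring_scope.

Lemma sum_insert_max (R : comNzRingType) (x : R) a m g :
  (0 < a <= 2)%N -> (a <= m.+1)%N -> (forall k, g k < m.+1)%N ->
  \sum_(p < m.+1) x ^+ npeaks a m.+1 (insert_at p.+1 m.+1 g)
  = (a%:R + (m.+1 - a)%:R * x + (2 * npeaks a m g)%:R * (1 - x)) * x ^+ npeaks a m g.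
Proof.
move=> a12 am gM; set k := npeaks a m g.
pose created p := (a <= p.+1 <= m)%N : nat.
pose destroyed p := ((a <= p < m) && peakb g p + (a <= p.+1 < m) && peakb g p.+1)%N.
have new_peaks p : (p < m.+1)%N ->
    npeaks a m.+1 (insert_at p.+1 m.+1 g) = (k + (created p - destroyed p))%N
    /\ (destroyed p <= created p <= (destroyed p).+1)%N.
  rewrite ltnS => pm; have := npeaks_insert a12 pm gM; have := peakb_nonadjacent g p.
  by rewrite /created /destroyed -/k; case: (peakb g p); case: (peakb g p.+1); lia.
have pow_slot p : (p < m.+1)%N -> x ^+ npeaks a m.+1 (insert_at p.+1 m.+1 g)
    = x ^+ k + (created p - destroyed p)%N%:R * (x ^+ k.+1 - x ^+ k).
  move=> /new_peaks [-> le_dc]; have : (created p - destroyed p <= 1)%N by lia.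
  case: (created p - destroyed p)%N => [|[|//]] _; first by rewrite addn0 mul0r addr0.
  by rewrite addn1 mul1r addrC subrK.
have sum_created : (\sum_(p < m.+1) created p = m.+1 - a)%N.
  rewrite (eq_bigr (fun p : 'I_m.+1 => ((a.-1 <= p < m) && predT p : nat))%N) => [|p _].
    by rewrite -(count_iota_sum predT) // count_predT size_iota; lia.
  by rewrite /created andbT; congr nat_of_bool; lia.
have le_dc (p : 'I_m.+1) : (destroyed p <= created p)%N.
  by have [_ /andP[]] := new_peaks p (ltn_ord p).
have sum_destroyed : (\sum_(p < m.+1) destroyed p = 2 * k)%N.
  by apply: sum_adjacent_peaks; case/andP: a12.
rewrite (eq_bigr _ (fun (p : 'I_m.+1) _ => pow_slot p (ltn_ord p))) big_split /=.
rewrite sumr_const card_ord -mulr_suml -natr_sum sumnB // sum_created sum_destroyed.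
rewrite natrB -?sum_created -?sum_destroyed ?leq_sum // sum_created natrB // exprS.
ring.
Qed.

Lemma big_perm_lift (R : Type) (idx : R) (op : Monoid.com_law idx) n
    (j : 'I_n.+1) (F : 'S_n.+1 -> R) :
  \big[op/idx]_(s : 'S_n.+1) F s
  = \big[op/idx]_(i : 'I_n.+1) \big[op/idx]_(s : 'S_n) F (lift_perm i j s).
Proof.
rewrite (partition_big (fun s : 'S_n.+1 => s^-1%g j) predT) //=.
apply: eq_bigr => i0 _.
rewrite (eq_bigl (fun s : 'S_n.+1 => s i0 == j)); last first.
  by move=> s; apply/eqP/eqP => [<-|<-]; rewrite ?permKV ?permK.
rewrite (reindex (lift_perm i0 j)); last first.
  pose ulsf i (s : 'S_n.+1) k := odflt k (unlift (s i) (s (lift i k))).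
  have ulsfK i (s : 'S_n.+1) k: lift (s i) (ulsf i s k) = s (lift i k).
    rewrite /ulsf; have:= neq_lift i k.
    by rewrite -(can_eq (permK s)) => /unlift_some[] ? ? ->.
  have inj_ulsf: injective (ulsf i0 _).
    move=> s; apply: can_inj (ulsf (s i0) s^-1%g) _ => k'.
    by rewrite {1}/ulsf ulsfK !permK liftK.
  exists (fun s => perm (inj_ulsf s)) => [s _ | s].
    by apply/permP=> k'; rewrite permE /ulsf lift_perm_lift lift_perm_id liftK.
  move/(s _ =P _) => si0; apply/permP=> k.
  case: (unliftP i0 k) => [k'|] ->; rewrite ?lift_perm_id //.
  by rewrite lift_perm_lift -si0 permE ulsfK.
by apply: eq_bigl => s; rewrite lift_perm_id eqxx.
Qed.

(* Qualified: [perm] exports another [pval]. *)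
Lemma pval_ord n (s : 'S_n) (j : 'I_n) : Defs.pval s j.+1 = (s j).+1.
Proof. by rewrite /Defs.pval valK. Qed.

Lemma pval_out n (s : 'S_n) k : (n <= k)%N -> Defs.pval s k.+1 = 0%N.
Proof. by move=> nk; rewrite /= insubN // -leqNgt. Qed.

Lemma pval_lt n (s : 'S_n) k : (Defs.pval s k < n.+1)%N.
Proof. by case: k => [|k] //=; case: insubP => [j _ _|_] //; rewrite ltnS ltn_ord. Qed.

Lemma pval_lift_max n (i : 'I_n.+1) (s : 'S_n) :
  Defs.pval (lift_perm i ord_max s) =1 insert_at i.+1 n.+1 (Defs.pval s).
Proof.
case=> [|k]; first by rewrite insert_at_lt.
have [kn|nk] := ltnP k n.+1; last first.
  rewrite pval_out // insert_at_gt ?ltnS 1?(leq_trans (ltn_ord i)) //.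
  by case: k nk => // k nk; rewrite pval_out.
rewrite -[k]/(val (Ordinal kn)) pval_ord.
case: (unliftP i (Ordinal kn)) => [j|] ->; last by rewrite lift_perm_id insert_at_eq.
rewrite lift_perm_lift lift_max /= /bump.
have [ij|ji] := leqP i j.
  by rewrite add1n insert_at_gt ?ltnS // pval_ord.
by rewrite add0n insert_at_lt // pval_ord.
Qed.

Definition peak_poly (R : nzRingType) a n : {poly R} :=
  \sum_(s : 'S_n) 'X^(npeaks a n (Defs.pval s)).

Lemma peak_poly1 (R : nzRingType) a : (0 < a)%N -> peak_poly R a 1 = 1.
Proof.
move=> a0; rewrite /peak_poly (eq_bigr (fun _ => 1)) => [|s _].
  by rewrite sumr_const card_Sn.
by rewrite /npeaks (_ : (1 - a = 0)%N) //; apply/eqP; rewrite subn_eq0.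
Qed.

Lemma peak_polyS (R : comNzRingType) a m : (0 < a <= 2)%N -> (a <= m.+1)%N ->
  peak_poly R a m.+1 = (a%:R + (m.+1 - a)%:R * 'X) * peak_poly R a m
                       + 2%:R * 'X * (1 - 'X) * (peak_poly R a m)^`().
Proof.
move=> a12 am; rewrite /peak_poly (big_perm_lift _ ord_max) exchange_big /=.
rewrite raddf_sum !mulr_sumr -big_split /=; apply: eq_bigr => s _.
under eq_bigr => i _ do rewrite (eq_npeaks _ _ (pval_lift_max i s)).
rewrite sum_insert_max //; last exact: pval_lt.
rewrite derivXn; case: (npeaks a m _) => [|k]; first by rewrite mulr0n mulr0 addr0; ring.
by rewrite -mulr_natr /= exprS; ring.
Qed.

Lemma Wpk_peak_poly (R : nzRingType) n (x : R) : Wpk n x = (peak_poly R 2 n).[x].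
Proof. by rewrite horner_sum; apply: eq_bigr => s _; rewrite hornerXn. Qed.

Lemma Wlpk_peak_poly (R : nzRingType) n (x : R) : Wlpk n x = (peak_poly R 1 n).[x].
Proof. by rewrite horner_sum; apply: eq_bigr => s _; rewrite hornerXn. Qed.

Section Reversal.
Variable R : nzRingType.
Implicit Types p q : {poly R}.

(* For [size p <= N.+1] this is [X^N p(1/X)], see [horner_revp]. *)
Definition revp N p : {poly R} := \poly_(i < N.+1) p`_(N - i).

Lemma coef_revp N p i : (revp N p)`_i = if (i <= N)%N then p`_(N - i) else 0.
Proof. by rewrite coef_poly ltnS. Qed.

Lemma revp0 p : revp 0 p = (p`_0)%:P.
Proof. by apply/polyP => -[|i]; rewrite coef_revp coefC. Qed.

Lemma revpD N : {morph revp N : p q / p + q}.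
Proof.
by move=> p q; apply/polyP => i; rewrite coefD !coef_revp coefD; case: ifP; rewrite ?addr0.
Qed.

Lemma revpXM N p : revp N.+1 ('X * p) = revp N p.
Proof.
apply/polyP => i; rewrite !coef_revp coefXM.
have [iN|Ni] := leqP i N; first by rewrite leqW // subSn.
by case: ifP => // _; rewrite subn_eq0 Ni.
Qed.

Lemma revpS N p : (size p <= N.+1)%N -> revp N.+1 p = 'X * revp N p.
Proof.
move=> sp; apply/polyP => i; rewrite coefXM !coef_revp.
case: i => [|i] /=; first by rewrite nth_default.
by rewrite ltnS subSS.
Qed.

Lemma revp_mul1X2 N p : (size p <= N.+1)%N ->
  revp N.+2 ((1 + 'X^2) * p) = (1 + 'X^2) * revp N p.
Proof.
move=> sp; rewrite expr2 !mulrDl !mul1r -!mulrA revpD !revpXM.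
by rewrite !revpS ?(leq_trans sp) // mulrA addrC.
Qed.

Lemma revp_deriv N p :
  revp N p^`() = N.+1%:R * revp N.+1 p - 'X * (revp N.+1 p)^`().
Proof.
apply/polyP => i; rewrite coefB coefXM mulr_natl coefMn coef_deriv !coef_revp.
case: i => [|i] /=; first by rewrite subr0 subn0 coef_deriv.
rewrite !ltnS; have [iN|Ni] := ltnP i N.
  by rewrite -mulrnBr ?coef_deriv ?ltnS ?(ltnW iN) // subSS subnSK.
case: leqP => [iN|_]; last by rewrite !mul0rn subr0.
have -> : i = N by apply/eqP; rewrite eqn_leq iN.
by rewrite subrr.
Qed.

Lemma size_deriv_le p : (size p^`() <= (size p).-1)%N.
Proof.
have [->|p0] := eqVneq p 0; first by rewrite deriv0 size_poly0.
by rewrite -ltnS prednK ?lt_size_deriv // size_poly_gt0.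
Qed.

Lemma size_mul1X2 p : (size ((1 + 'X^2) * p)%R <= (size p).+2)%N.
Proof.
apply: leq_trans (size_polyMleq _ _) _.
by rewrite addrC size_polyDl size_polyXn ?size_poly1.
Qed.

End Reversal.

Lemma horner_revp (F : fieldType) N (p : {poly F}) x :
  (size p <= N.+1)%N -> x != 0 -> (revp N p).[x] = x ^+ N * p.[x^-1].
Proof.
move=> sp x0; rewrite /revp horner_poly (horner_coef_wide _ sp) mulr_sumr.
rewrite (reindex_inj rev_ord_inj) /=; apply: eq_bigr => i _.
have iN : (i <= N)%N by rewrite -ltnS.
rewrite subKn // exprVn subSS.
have -> : x ^+ N = x ^+ (N - i) * x ^+ i by rewrite -exprD subnK.
by rewrite -mulrA [x ^+ i * _]mulrCA mulfV ?expf_neq0 // mulr1 mulrC.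
Qed.

Section TangentSecant.
Variable R : comNzRingType.

Lemma size_Ppoly n : (size (Ppoly R n) <= n.+2)%N.
Proof.
elim: n => [|n IH] /=; first by rewrite size_polyX.
apply: leq_trans (size_mul1X2 _) _; rewrite !ltnS.
by apply: leq_trans (size_deriv_le _) _; rewrite -subn1 leq_subLR add1n.
Qed.

Lemma size_Qpoly n : (size (Qpoly R n) <= n.+1)%N.
Proof.
elim: n => [|n IH] /=; first by rewrite size_poly1.
apply: leq_trans (size_polyD _ _) _; rewrite geq_max; apply/andP; split.
  apply: leq_trans (size_mul1X2 _) _; rewrite !ltnS.
  by apply: leq_trans (size_deriv_le _) _; rewrite -subn1 leq_subLR add1n.
by apply: leq_trans (size_polyMleq _ _) _; rewrite size_polyX.
Qed.

Lemma deriv_1X2 : (1 + 'X^2 : {poly R})^`() = 2%:R * 'X.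
Proof. by rewrite derivD derivC derivXn add0r mulr_natl. Qed.

Lemma deriv_comp_1X2 (p : {poly R}) :
  (p \Po (1 + 'X^2))^`() = 2%:R * 'X * (p^`() \Po (1 + 'X^2)).
Proof. by rewrite deriv_comp deriv_1X2 mulrC. Qed.

Lemma revp_Ppoly n : (0 < n)%N ->
  revp n.+1 (Ppoly R n) = (1 + 'X^2) * (peak_poly R 2 n \Po (1 + 'X^2)).
Proof.
case: n => // n _; elim: n => [|n IH].
  rewrite peak_poly1 // rmorph1 /= derivX revp_mul1X2 ?size_poly1 //.
  by rewrite revp0 coef1 polyC1.
rewrite [Ppoly R _]/= revp_mul1X2; last first.
  apply: leq_trans (size_deriv_le _) _; rewrite -subn1 leq_subLR add1n.
  exact: (size_Ppoly n.+1).
rewrite revp_deriv IH derivM deriv_comp_1X2 deriv_1X2.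
rewrite (peak_polyS R (a := 2) (m := n.+1)) // !subSS subn0.
rewrite !(comp_polyB, comp_polyD, comp_polyM, comp_polyX) (rmorph1 (comp_poly _)).
rewrite !(rmorph_nat (comp_poly _)).
move: (peak_poly R 2 n.+1 \Po _) ((peak_poly R 2 n.+1)^`() \Po _) => A B.
ring.
Qed.

Lemma revp_Qpoly n : (0 < n)%N ->
  revp n (Qpoly R n) = peak_poly R 1 n \Po (1 + 'X^2).
Proof.
case: n => // n _; elim: n => [|n IH].
  rewrite peak_poly1 // rmorph1 /= derivC mulr0 add0r mulr1.
  by rewrite -[X in revp 1 X]mulr1 revpXM revp0 coef1 polyC1.
rewrite [Qpoly R _]/= revpD revpXM revp_mul1X2; last first.
  apply: leq_trans (size_deriv_le _) _; rewrite -subn1 leq_subLR add1n.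
  exact: (size_Qpoly n.+1).
rewrite revp_deriv IH deriv_comp_1X2.
rewrite (peak_polyS R (a := 1) (m := n.+1)) // !subSS subn0.
rewrite !(comp_polyB, comp_polyD, comp_polyM, comp_polyX) (rmorph1 (comp_poly _)).
rewrite !(rmorph_nat (comp_poly _)).
move: (peak_poly R 1 n.+1 \Po _) ((peak_poly R 1 n.+1)^`() \Po _) => A B.
ring.
Qed.

End TangentSecant.

Theorem mainTheorem2 (R : realType) (n : nat) (u : R) :
  (1 <= n)%N -> 1 < u ->
  Wpk n u = (u - 1) `^ ((n.+1)%:R / 2) * u^-1 * (Ppoly R n).[(u - 1) `^ (- 2^-1)]
  /\ Wlpk n u = (u - 1) `^ (n%:R / 2) * (Qpoly R n).[(u - 1) `^ (- 2^-1)].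
Proof.
move=> n_gt0 u_gt1; have u1_gt0 : 0 < u - 1 by rewrite subr_gt0.
set s := (u - 1) `^ 2^-1.
have s_gt0 : 0 < s by rewrite powR_gt0.
have pow_s k : (u - 1) `^ (k%:R / 2) = s ^+ k.
  by rewrite -powR_mulrn ?ltW // -powRrM mulrC.
have u_s : u = (1 + 'X^2 : {poly R}).[s].
  by rewrite !hornerE -pow_s divff ?pnatr_eq0 // powRr1 ?ltW //; ring.
rewrite powRN -/s !pow_s Wpk_peak_poly Wlpk_peak_poly; split.
  have := congr1 (horner^~ s) (revp_Ppoly R n_gt0).
  rewrite horner_revp ?size_Ppoly ?gt_eqF // hornerM horner_comp -u_s mulrAC => ->.
  by rewrite mulrAC mulfV ?mul1r // gt_eqF // (lt_trans ltr01).
have := congr1 (horner^~ s) (revp_Qpoly R n_gt0).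
by rewrite horner_revp ?size_Qpoly ?gt_eqF // horner_comp -u_s => ->.
Qed.
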